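(* Let $p,q$ be integers with $1\le p$ and $p<q-p$ (coprimality not required), and let $u=0^{q-p}1^p$. For a binary word $w\in\{0,1\}^q$ with exactly $p$ ones, put $P(w)=\prod_{i=1}^q\mathcal{I}_i(w)$. Then $P$ is minimized precisely on the orbit of $u$: for every such $w$ that is not a cyclic shift of $u$, $P(u)<P(w)$.
   Context: Binary alphabet $\{0,1\}$ with $0<1$; words of equal length are compared lexicographically. For a word $x=x_1\cdots x_n$, $(x)_2=\sum_{i=1}^n x_i2^{n-i}$. The cyclic shift is $\sigma(w_1\cdots w_n)=w_2\cdots w_nw_1$. For $w\in\{0,1\}^q$, $\mathcal{O}_1(w)\le\dots\le\mathcal{O}_q(w)$ are the $q$ words $w,\sigma(w),\dots,\sigma^{q-1}(w)$ sorted lexicographically (with repetition), and $\mathcal{I}_k(w)=(\mathcal{O}_k(w))_2$. *)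

(* Defs.v *)
From mathcomp Require Import all_boot.
Set Implicit Arguments. Unset Strict Implicit. Unset Printing Implicit Defensive.

Fixpoint lexle (x y : seq bool) : bool :=
  match x, y with
  | [::], _ => true
  | _ :: _, [::] => false
  | a :: x', b :: y' => (a < b) || ((a == b) && lexle x' y')
  end.

Definition bin_val (x : seq bool) : nat :=
  foldl (fun acc (b : bool) => acc.*2 + b) 0 x.

Definition sigma (w : seq bool) : seq bool := rot 1 w.

Definition orbit_sorted (w : seq bool) : seq (seq bool) :=
  sort lexle [seq iter k sigma w | k <- iota 0 (size w)].

Definition Ik (w : seq bool) (k : nat) : nat :=
  bin_val (nth [::] (orbit_sorted w) k.-1).

Definition Pw (w : seq bool) : nat := \prod_(1 <= i < (size w).+1) Ik w i.

Definition u_word (p q : nat) : seq bool := nseq (q - p) false ++ nseq p true.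

(* Main.v *)
(* Let n = q - p and N = 2^q - 1.  The k smallest rotations of u have values
   2^j (2^p - 1), j < k (for k <= n), with sum (2^k - 1)(2^p - 1).  An induction
   on linear words shows that any k rotations of w starting with 0 have at least
   this sum; complementing the alphabet gives the same for the numbers N - value
   of the rotations starting with 1.  Pair the values x_i of u with the values
   y_i of w in sorted order: Abel summation against the monotone weights 1 / y_i
   turns these bounds on partial sums into sum_i x_i / y_i <= q, the leftover
   boundary terms cancelling because both orbits have the same total p N.  By
   AM-GM prod_i x_i <= prod_i y_i, strictly since the smallest y_i exceeds
   2^p - 1 when w is not a rotation of u. *)
Require Import Defs.
From mathcomp Require Import all_boot all_order all_algebra.
From mathcomp Require Import zify ring lra.
Set Implicit Arguments. Unset Strict Implicit. Unset Printing Implicit Defensive.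
Import Order.TTheory GRing.Theory Num.Theory.

(** * Values of binary words *)

Lemma bin_val_cat s t : bin_val (s ++ t) = bin_val s * 2 ^ size t + bin_val t.
Proof.
have foldE x a :
    foldl (fun acc (b : bool) => acc.*2 + b) a x = a * 2 ^ size x + bin_val x.
  rewrite /bin_val; elim: x a => [|b x IH] a /=; first by lia.
  by rewrite IH [in RHS]IH expnS; nia.
by rewrite /bin_val foldl_cat foldE.
Qed.

Lemma bin_val_cons b s : bin_val (b :: s) = b * 2 ^ size s + bin_val s.
Proof. by rewrite -cat1s bin_val_cat. Qed.

Lemma bin_val_nseq0 n : bin_val (nseq n false) = 0.
Proof. by elim: n => //= n IH; rewrite bin_val_cons IH. Qed.

Lemma bin_val_nseq1 n : bin_val (nseq n true) = 2 ^ n - 1.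
Proof.
elim: n => //= n IH; rewrite bin_val_cons IH size_nseq expnS.
by have := expn_gt0 2 n; lia.
Qed.

Lemma bin_val_negb s : bin_val s + bin_val (map negb s) = 2 ^ size s - 1.
Proof.
elim: s => //= b s IH; rewrite !bin_val_cons size_map expnS.
by have := expn_gt0 2 (size s); case: b => /=; lia.
Qed.

Lemma bin_val_inj s t : size s = size t -> bin_val s = bin_val t -> s = t.
Proof.
have ub x : bin_val x < 2 ^ size x.
  by have := bin_val_negb x; have := expn_gt0 2 (size x); lia.
elim: s t => [|a s IH] [|b t] //= [Est]; rewrite !bin_val_cons Est => E.
have := ub s; have := ub t; rewrite Est => ut us.
have Eab : a = b by case: a b E => -[] //=; lia.
by rewrite Eab (IH t) //; lia.
Qed.

(** Among words of given length and number of ones, the value is least when all ones stand at the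
    end. *)
Lemma bin_val_lower s : 2 ^ count id s - 1 <= bin_val s.
Proof.
elim: s => //= b s IH; rewrite bin_val_cons.
have : 2 ^ count id s <= 2 ^ size s by rewrite leq_exp2l ?count_size.
by case: b => /=; rewrite ?add0n ?add1n ?expnS; lia.
Qed.

Lemma bin_val_upper s : bin_val s + 2 ^ count negb s <= 2 ^ size s.
Proof.
have := bin_val_lower (map negb s); have := bin_val_negb s.
rewrite count_map (eq_count (a2 := negb)) //.
by have := expn_gt0 2 (count negb s); have := expn_gt0 2 (size s); lia.
Qed.

(** * Sums of values over selected rotations *)

(** The selection is a predicate on positions, so that removing the first letter merely turns [k]
    into [k \o succn] in the inductions below. *)
Definition zeros_only (k : pred nat) (v : seq bool) :=
  forall i, i < size v -> k i -> nth true v i = false.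

Lemma zeros_only_behead k b v :
  zeros_only k (b :: v) -> zeros_only (k \o succn) v.
Proof. by move=> kz i; apply: (kz i.+1). Qed.

Lemma zeros_only_count k v :
  zeros_only k v -> \sum_(i < size v) k i <= count negb v.
Proof.
elim: v k => [|b v IH] k kz /=; first by rewrite big_ord0.
rewrite big_ord_recl /=; have /= := IH _ (zeros_only_behead kz).
under [in X in X -> _]eq_bigr do rewrite /=.
under [in X in _ -> X]eq_bigr do rewrite /bump /= add1n.
move=> le; apply: leq_add => //.
by case: b kz => /= [/(_ 0 isT)|]; case: (k 0) => // /(_ isT).
Qed.

(* What a leading 1 adds to the sum over the rotations in [rot_sum_lower]. *)
Lemma suffix_sum_lower k v : zeros_only k v ->
  2 ^ count id v * 2 ^ (\sum_(i < size v) k i) <=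
  \sum_(i < size v) k i * (2 ^ i * (bin_val (drop i v)).+1) + 2 ^ count id v.
Proof.
elim: v k => [|b v IH] k kz /=; first by rewrite !big_ord0.
rewrite !big_ord_recl /= mul1n.
have {IH} := IH _ (zeros_only_behead kz).
have -> : \sum_(i < size v) k (bump 0 i) * (2 ^ bump 0 i * (bin_val (drop i v)).+1)
   = 2 * \sum_(i < size v) (k \o succn) i * (2 ^ i * (bin_val (drop i v)).+1).
  by rewrite big_distrr /=; apply: eq_bigr => i _; rewrite /bump add1n expnS; lia.
have -> : \sum_(i < size v) k (bump 0 i) = \sum_(i < size v) (k \o succn) i by [].
have k0 : k 0 -> b = false by apply: (kz 0).
(* For a selected position 0, twice the induction hypothesis leaves [2 ^ count id v] to be covered;
   the value of [v] plus one covers it. *)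
have := bin_val_lower v.
rewrite bin_val_cons.
set S := \sum_(i < _) _ * _; set c := \sum_(i < _) _.
have := expn_gt0 2 (count id v); have := expn_gt0 2 c.
case: (k 0) k0 => [->|_] //=; first by rewrite add1n add0n expnS; nia.
rewrite !add0n; case: b kz => kz /=; rewrite ?add0n ?add1n ?expnS; nia.
Qed.

(* What a leading zero adds to that sum when its own rotation is selected. *)
Lemma affine_sum_lower k v : zeros_only k v ->
  2 ^ count id v * 2 ^ (\sum_(i < size v) k i) <=
  bin_val v + \sum_(i < size v) k i * (2 ^ i * bin_val (drop i v))
  + 2 ^ (\sum_(i < size v) k i).
Proof.
elim: v k => [|b v IH] k kz /=; first by rewrite !big_ord0.
rewrite !big_ord_recl /= mul1n.
have {IH} := IH _ (zeros_only_behead kz).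
have -> : \sum_(i < size v) k (bump 0 i) * (2 ^ bump 0 i * bin_val (drop i v))
   = 2 * \sum_(i < size v) (k \o succn) i * (2 ^ i * bin_val (drop i v)).
  by rewrite big_distrr /=; apply: eq_bigr => i _; rewrite /bump add1n expnS; lia.
have -> : \sum_(i < size v) k (bump 0 i) = \sum_(i < size v) (k \o succn) i by [].
have k0 : k 0 -> b = false by apply: (kz 0).
(* For a leading 1, twice the induction hypothesis requires [bin_val v + 2 ^ c <= 2 ^ size v]; this
   holds because the [c] selected positions are zeros of [v]. *)
have := bin_val_upper v.
have : 2 ^ (\sum_(i < size v) (k \o succn) i) <= 2 ^ count negb v.
  by rewrite leq_exp2l // zeros_only_count //; apply: zeros_only_behead kz.
rewrite bin_val_cons.
set S := \sum_(i < _) _ * _; set c := \sum_(i < _) _.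
have := expn_gt0 2 (count id v); have := expn_gt0 2 c.
case: (k 0) k0 => [->|_] //=; first by rewrite add1n !add0n expnS; nia.
rewrite !add0n; case: b kz => kz /=; rewrite ?add0n ?add1n ?expnS; nia.
Qed.

Lemma bin_val_rot i v : i <= size v ->
  bin_val (rot i v) = 2 ^ i * bin_val (drop i v) + bin_val (take i v).
Proof. by move=> ?; rewrite bin_val_cat size_takel // mulnC. Qed.

(** Induction on the word. The bound is attained by 0^n 1^p when the selection consists of its first
    positions. *)
Lemma rot_sum_lower k v : zeros_only k v ->
  (2 ^ count id v - 1) * (2 ^ (\sum_(i < size v) k i) - 1) <=
  \sum_(i < size v) k i * bin_val (rot i v).
Proof.
elim: v k => [|b v IH] k kz /=; first by rewrite !big_ord0.
have kz' := zeros_only_behead kz.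
have {IH} := IH _ kz'.
rewrite !big_ord_recl /= rot0.
have -> : \sum_(i < size v) k (bump 0 i) = \sum_(i < size v) (k \o succn) i by [].
(* The new letter [b] lands just after [drop i v]: that suffix moves up one binary place and [b]
   itself contributes [b * 2 ^ i]. *)
have -> : \sum_(i < size v) k (bump 0 i) * bin_val (rot (bump 0 i) (b :: v)) =
   \sum_(i < size v) (k \o succn) i * bin_val (rot i v)
   + \sum_(i < size v) (k \o succn) i * (2 ^ i * (bin_val (drop i v) + b)).
  rewrite -big_split /=; apply: eq_bigr => i _.
  have ? := ltn_ord i.
  rewrite /bump add1n -mulnDr; congr (_ * _).
  rewrite !bin_val_rot ?ltnS //= 1?ltnW // bin_val_cons size_takel 1?ltnW //.
  by rewrite expnS; nia.
have k0 : k 0 -> b = false by apply: (kz 0).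
have := suffix_sum_lower kz'; have := affine_sum_lower kz'.
rewrite bin_val_cons.
have := expn_gt0 2 (count id v).
have := expn_gt0 2 (\sum_(i < size v) (k \o succn) i).
(* A selected 0 must gain [(2 ^ count id v - 1) * 2 ^ c], which is the affine bound; a leading 1
   must gain [2 ^ count id v * (2 ^ c - 1)], which is the suffix bound; an unselected 0 needs no
   gain. *)
case: (k 0) k0 => [->|_] //=; last case: b kz => kz /=.
- under [X in _ <= _ + (_ + X)]eq_bigr do rewrite addn0.
  set S := \sum_(i < _) _ * _; set T := \sum_(i < _) _ * _.
  rewrite add1n !add0n expnS; nia.
- under [X in _ <= _ + (_ + X)]eq_bigr do rewrite addn1.
  set S := \sum_(i < _) _ * _; set T := \sum_(i < _) _ * _.
  rewrite add1n !add0n expnS; nia.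
- by rewrite !add0n => _ _ _ _ /leq_trans; apply; apply: leq_addr.
Qed.

(* One rotation step doubles the value and, if the first letter is 1, subtracts
   [2 ^ size v - 1]; the sum over the whole orbit is invariant. *)
Lemma rot_sum v : \sum_(i < size v) bin_val (rot i v) = count id v * (2 ^ size v - 1).
Proof.
have step i : i < size v -> bin_val (rot i.+1 v) + nth false v i * (2 ^ size v - 1)
   = 2 * bin_val (rot i v).
  move=> lt; rewrite bin_val_rot // bin_val_rot ?(ltnW lt) // [drop i v](drop_nth false) // (take_nth false) //.
  rewrite -cats1 bin_val_cat !bin_val_cons size_drop expnS /=.
  have -> : 2 ^ size v = 2 * (2 ^ i * 2 ^ (size v - i.+1)).
    by rewrite -expnD -expnS; congr (_ ^ _); lia.
  have := expn_gt0 2 i; have := expn_gt0 2 (size v - i.+1).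
  by case: (nth _ _ _) => /=; rewrite /bin_val /=; nia.
have cnt : \sum_(i < size v) nth false v i = count id v.
  by rewrite -sum1_count (big_nth false) big_mkord [RHS]big_mkcond; apply: eq_bigr => i _; case: nth.
have : \sum_(i < size v) bin_val (rot i.+1 v) + count id v * (2 ^ size v - 1)
   = 2 * \sum_(i < size v) bin_val (rot i v).
  rewrite -cnt big_distrl big_distrr -big_split /=.
  by apply: eq_bigr => i _; rewrite step.
(* Shifting the index only moves round the cycle, since [rot (size v) v] is [v]. *)
suff -> : \sum_(i < size v) bin_val (rot i.+1 v) = \sum_(i < size v) bin_val (rot i v).
  by lia.
case: v {step cnt} => [|b v]; first by rewrite !big_ord0.
rewrite big_ord_recr [RHS]big_ord_recl /= rot_oversize // rot0 addnC.
by congr (_ + _); apply: eq_bigr => i _.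
Qed.

(** * Rotations starting with 0, in increasing order *)

(** Positions are sorted rather than words, so that equal rotations of a periodic word keep their
    multiplicity while the entries stay distinct. *)
Definition zero_pos (w : seq bool) : seq nat :=
  sort (relpre (fun i => bin_val (rot i w)) leq)
    [seq i <- iota 0 (size w) | ~~ nth true w i].

(* [zval w j] is the j-th smallest value (from 0) among the rotations of [w]
   starting with 0. *)
Definition zval (w : seq bool) (j : nat) : nat :=
  bin_val (rot (nth 0 (zero_pos w) j) w).

Lemma mem_zero_pos w i : (i \in zero_pos w) = (i < size w) && ~~ nth true w i.
Proof. by rewrite mem_sort mem_filter mem_iota add0n andbC. Qed.

Lemma size_zero_pos w : size (zero_pos w) = count negb w.
Proof.
rewrite size_sort size_filter -[w in RHS](mkseq_nth true) /mkseq count_map.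
exact: eq_count.
Qed.

Lemma zero_pos_uniq w : uniq (zero_pos w).
Proof. by rewrite sort_uniq filter_uniq // iota_uniq. Qed.

Lemma nth_zero_pos w j : j < count negb w ->
  nth 0 (zero_pos w) j < size w /\ nth true w (nth 0 (zero_pos w) j) = false.
Proof.
rewrite -size_zero_pos => /(mem_nth 0); rewrite mem_zero_pos => /andP[-> /negbTE].
by [].
Qed.

Lemma big_zval (R : Type) (idx : R) (op : Monoid.com_law idx) (F : nat -> R) w :
  \big[op/idx]_(j < count negb w) F (zval w j) =
  \big[op/idx]_(i < size w | ~~ nth true w i) F (bin_val (rot i w)).
Proof.
rewrite -size_zero_pos -(big_mkord xpredT (fun j => F (zval w j))).
rewrite -(big_nth 0 xpredT (fun i => F (bin_val (rot i w)))).
rewrite (perm_big _ (permEl (perm_sort _ _))) /= big_filter.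
by rewrite -[X in iota _ X]subn0 big_mkord.
Qed.

Lemma zval_homo w i j : i <= j -> j < count negb w -> zval w i <= zval w j.
Proof.
move=> le_ij lt_j.
apply: (sorted_leq_nth (leT := relpre (fun i => bin_val (rot i w)) leq)) => //.
- by move=> a b c /=; apply: leq_trans.
- by move=> a /=.
- by apply: sort_sorted => a b; apply: leq_total.
- by rewrite inE size_zero_pos (leq_ltn_trans le_ij).
- by rewrite inE size_zero_pos.
Qed.

(** The first [k] entries of [zero_pos w] are distinct positions of zeros, hence a selection to
    which [rot_sum_lower] applies. *)
Lemma zval_sum_lower w k : k <= count negb w ->
  (2 ^ count id w - 1) * (2 ^ k - 1) <= \sum_(j < k) zval w j.
Proof.
move=> le_k; pose K := take k (zero_pos w).
have sK : size K = k by rewrite size_takel ?size_zero_pos.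
have uK : uniq K by rewrite take_uniq ?zero_pos_uniq.
have sum_K (F : nat -> nat) : \sum_(j < k) F (nth 0 (zero_pos w) j)
    = \sum_(i < size w) (val i \in K) * F i.
  transitivity (\sum_(i <- K) F i).
    rewrite (big_nth 0) big_mkord sK; apply: eq_bigr => j _.
    by rewrite nth_take.
  have KP : perm_eq K [seq i <- iota 0 (size w) | i \in K].
    apply: uniq_perm => //; first by rewrite filter_uniq ?iota_uniq.
    move=> i; rewrite mem_filter mem_iota add0n; case: (boolP (i \in K)) => //.
    by move/mem_take; rewrite mem_zero_pos => /andP[].
  rewrite (perm_big _ KP) big_filter big_mkcond -[X in iota _ X]subn0 big_mkord.
  by apply: eq_bigr => i _; case: (_ \in _); rewrite ?mul1n.
have Kz : zeros_only (fun i => i \in K) w.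
  by move=> i _ /mem_take; rewrite mem_zero_pos => /andP[_ /negbTE].
have := rot_sum_lower Kz; rewrite -(sum_K (fun i => bin_val (rot i w))).
have -> // : \sum_(i < size w) (val i \in K) = k.
transitivity (\sum_(i < size w) (val i \in K) * 1).
  by apply: eq_bigr => i _; rewrite muln1.
by rewrite -(sum_K (fun=> 1)) sum1_card card_ord.
Qed.

Lemma zval_upper w j : j < count negb w -> 2 * zval w j <= 2 ^ size w - 1.
Proof.
case/nth_zero_pos; rewrite /zval; set i := nth 0 _ _ => lt_i w_i.
have : bin_val (rot i w) = bin_val (behead (rot i w)).
  by rewrite /rot (drop_nth true) // w_i /= bin_val_cons.
have := bin_val_upper (behead (rot i w)).
have : size (rot i w) = size w by rewrite size_rot.
case: (rot i w) => [|b v] //= <-; rewrite expnS => H ->.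
by have := expn_gt0 2 (count negb v); lia.
Qed.

(** * Complementation and the rotations starting with 1 *)

Lemma count_negb_map w : count negb (map negb w) = count id w.
Proof. by rewrite count_map; apply: eq_count => b /=; rewrite negbK. Qed.

Lemma count_id_map w : count id (map negb w) = count negb w.
Proof. by rewrite count_map; apply: eq_count. Qed.

Lemma bin_val_rot_negb i w :
  bin_val (rot i w) = 2 ^ size w - 1 - bin_val (rot i (map negb w)).
Proof. by have := bin_val_negb (rot i w); rewrite -map_rot size_rot; lia. Qed.

(* The rotations starting with 1 are read off the complemented word. *)
Lemma big_rot (R : Type) (idx : R) (op : Monoid.com_law idx) (F : nat -> R) w :
  \big[op/idx]_(i < size w) F (bin_val (rot i w)) =
  op (\big[op/idx]_(j < count negb w) F (zval w j))
     (\big[op/idx]_(j < count id w) F (2 ^ size w - 1 - zval (map negb w) j)).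
Proof.
rewrite (bigID (fun i : 'I__ => ~~ nth true w i)) /= -big_zval; congr (op _ _).
rewrite -count_negb_map (big_zval _ (fun x => F (2 ^ size w - 1 - x))) size_map.
apply: eq_big => [i|i _]; last by rewrite bin_val_rot_negb.
by rewrite (nth_map true).
Qed.

(** The whole orbit sums to [count id w * (2 ^ size w - 1)]; the rotations starting with 1 fall
    short of this by the right-hand sum, and those starting with 0 make up the difference. *)
Lemma zval_sum_negb w :
  \sum_(j < count negb w) zval w j = \sum_(j < count id w) zval (map negb w) j.
Proof.
have := rot_sum w; rewrite (big_rot _ id) /=.
have : \sum_(j < count id w) (2 ^ size w - 1 - zval (map negb w) j)
    + \sum_(j < count id w) zval (map negb w) j = count id w * (2 ^ size w - 1).
  rewrite -big_split /= -[X in _ = X * _]card_ord -sum_nat_const.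
  apply: eq_bigr => j _; have := @zval_upper (map negb w) j.
  by rewrite count_negb_map size_map => /(_ (ltn_ord j)); lia.
by move=> <- /eqP; rewrite addnC eqn_add2l => /eqP.
Qed.

(** * The product over the orbit, and its factors for 0^n 1^p *)

Lemma iter_sigma i w : i <= size w -> iter i sigma w = rot i w.
Proof.
elim: i => [|i IH] lt_i /=; first by rewrite rot0.
by rewrite (IH (ltnW lt_i)) rotS.
Qed.

Lemma PwE w : Pw w = \prod_(i < size w) bin_val (rot i w).
Proof.
have sz : size (orbit_sorted w) = size w by rewrite size_sort size_map size_iota.
rewrite /Pw big_add1 /= -{1}sz -(big_nth [::] xpredT bin_val).
rewrite (perm_big _ (permEl (perm_sort _ _))) /= big_map.
rewrite -[X in iota _ X]subn0 big_mkord.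
by apply: eq_bigr => i _; rewrite iter_sigma // ltnW.
Qed.

Lemma bin_val_block a b c :
  bin_val (nseq a false ++ nseq b true ++ nseq c false) = 2 ^ c * (2 ^ b - 1).
Proof.
by rewrite !bin_val_cat !bin_val_nseq0 bin_val_nseq1 !size_nseq mul0n addn0 mulnC.
Qed.

Lemma bin_val_rot_block i n p : i < n ->
  bin_val (rot i (nseq n false ++ nseq p true)) = 2 ^ i * (2 ^ p - 1).
Proof.
move=> lt_i; rewrite -(bin_val_block (n - i)) /rot drop_cat take_cat size_nseq lt_i.
by rewrite drop_nseq take_nseq 1?ltnW // -catA.
Qed.

Lemma Pw_u_word n p : Pw (nseq n false ++ nseq p true) =
  (\prod_(j < n) (2 ^ j * (2 ^ p - 1))) *
  \prod_(j < p) (2 ^ (n + p) - 1 - 2 ^ j * (2 ^ n - 1)).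
Proof.
rewrite PwE size_cat !size_nseq big_split_ord /=; congr (_ * _).
  by apply: eq_bigr => j _; rewrite bin_val_rot_block.
apply: eq_bigr => j _; rewrite bin_val_rot_negb size_cat !size_nseq.
(* The complement 1^n 0^p rotated by [n] is 0^p 1^n, so the block formula applies with [n] and [p]
   exchanged. *)
rewrite map_cat !map_nseq [in rot _ _]addnC rotD; last first.
  by rewrite size_cat !size_nseq addnC leq_add2l ltnW.
by rewrite -{2}(size_nseq n true) rot_size_cat bin_val_rot_block.
Qed.

(** The least value with [p] ones is attained only by 0^n 1^p; a rotation of [w] attaining it could
    be rotated back by [n + p - i] to exhibit [w] in that orbit. *)
Lemma zval_gt_min n p w : size w = n + p -> count id w = p ->
  (forall k, w != iter k sigma (nseq n false ++ nseq p true)) ->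
  forall j, j < count negb w -> 2 ^ p - 1 < zval w j.
Proof.
move=> sw cw nw j /nth_zero_pos[]; rewrite /zval; set i := nth 0 _ _ => lt_i _.
have := bin_val_lower (rot i w); rewrite -{1}cw.
have -> : count id (rot i w) = count id w by apply/permP; rewrite perm_rot.
rewrite leq_eqVlt => /orP[/eqP E|//]; case/negP: (nw (n + p - i)); apply/eqP.
rewrite iter_sigma ?size_cat ?size_nseq ?leq_subr //.
have -> : nseq n false ++ nseq p true = rot i w.
  apply: bin_val_inj; first by rewrite size_rot size_cat !size_nseq.
  by rewrite -E bin_val_cat bin_val_nseq0 bin_val_nseq1 cw.
by rewrite -[in LHS](rotK i w) /rotr size_rot sw.
Qed.

(** * Abel summation and AM-GM with its equality case *)

(** As the full sum of [d] is nonnegative, [H] may be lowered to the last weight [h n]; the last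
    term then cancels and [h n] serves as the bound for the shorter sum. *)
Lemma abel_sum_le (F : realFieldType) (n : nat) (d h : nat -> F) (H : F) :
  (forall k, (k <= n)%N -> 0 <= \sum_(i < k) d i)%R ->
  (forall i j, (i <= j)%N -> (j < n)%N -> h i <= h j)%R ->
  (forall i, (i < n)%N -> h i <= H)%R ->
  (\sum_(i < n) d i * h i <= H * \sum_(i < n) d i)%R.
Proof.
elim: n H => [|n IH] H d_ge0 h_mono h_le; first by rewrite !big_ord0 mulr0.
apply: (@le_trans _ _ (h n * \sum_(i < n.+1) d i)%R); last first.
  by rewrite ler_wpM2r ?h_le ?d_ge0.
rewrite !big_ord_recr /= mulrDr [(h n * d n)%R]mulrC lerD2r.
apply: IH => [k le_k|i j le_ij lt_j|i lt_i].
- by rewrite d_ge0 // leqW.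
- by rewrite h_mono // ltnW.
- by rewrite h_mono // ltnW.
Qed.

Lemma prod_lt_of_sum_ratio (F : realFieldType) (q : nat) (x y : 'I_q -> F) (i0 : 'I_q) :
  (forall i, 0 <= x i)%R -> (forall i, 0 < y i)%R ->
  (\sum_i x i / y i <= q%:R)%R -> (x i0 < y i0)%R ->
  (\prod_i x i < \prod_i y i)%R.
Proof.
move=> x_ge0 y_gt0 sum_le lt0.
have r_ge0 i : (0 <= x i / y i)%R by rewrite divr_ge0 // ltW.
have q_gt0 : (0 < q%:R :> F)%R by rewrite ltr0n (leq_trans _ (ltn_ord i0)).
suff : (\prod_i (x i / y i) < 1)%R.
  by rewrite big_split /= prodfV ltr_pdivrMr ?mul1r // prodr_gt0.
have [/= + eqE] := @leif_AGM F _ predT (fun i => x i / y i)%R (fun i _ => r_ge0 i).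
move: eqE; rewrite card_ord => eqE le_mean.
have mean_le1 : ((\sum_(i in predT) x i / y i) / q%:R <= 1)%R.
  by rewrite ler_pdivrMr // mul1r.
have mean_ge0 : (0 <= (\sum_(i in predT) x i / y i) / q%:R)%R.
  by rewrite divr_ge0 ?sumr_ge0 // ltW.
have pow_le1 := exprn_ile1 q mean_ge0 mean_le1.
rewrite lt_neqAle (le_trans le_mean pow_le1) andbT; apply/eqP => prod1.
have all_eq : (\prod_(i in predT) (x i / y i) ==
    ((\sum_(i in predT) x i / y i) / q%:R) ^+ q)%R.
  by rewrite eq_le le_mean /= (le_trans pow_le1) // prod1.
move: all_eq; rewrite eqE => /forall_inP eq_r.
(* In the equality case all ratios coincide with the one at [i0], which is below 1. *)
have r_lt1 i : (x i / y i < 1)%R.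
  have /forall_inP/(_ i0 isT)/eqP -> := eq_r i isT.
  by rewrite ltr_pdivrMr // mul1r.
have : (\prod_i (x i / y i) < 1)%R; last by rewrite prod1 ltxx.
rewrite (bigD1 i0) //= -[ltRHS]mulr1.
have : (\prod_(i | i != i0) (x i / y i) <= 1)%R.
  by apply: prodr_ile1 => i; rewrite r_ge0 ltW.
move=> le1; apply: (le_lt_trans (ler_wpM2l (r_ge0 i0) le1)).
by rewrite mulr1 mulr1.
Qed.

(** * Excess over the orbit of 0^n 1^p and the final comparison *)

Lemma sum_geometric2 c k : \sum_(j < k) 2 ^ j * c = (2 ^ k - 1) * c.
Proof.
elim: k => [|k IH]; first by rewrite big_ord0.
by rewrite big_ord_recr /= IH expnS; have := expn_gt0 2 k; nia.
Qed.

(** The subtracted term is the corresponding value for 0^n 1^p. Single excesses can be negative,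
    hence [rat]; only their partial sums are bounded below. *)
Definition zexcess (w : seq bool) (j : nat) : rat :=
  ((zval w j)%:R - (2 ^ j * (2 ^ count id w - 1))%:R)%R.

Lemma zexcess_sum w k :
  (\sum_(j < k) zexcess w j = (\sum_(j < k) zval w j)%:R
     - ((2 ^ k - 1) * (2 ^ count id w - 1))%:R)%R.
Proof. by rewrite sumrB -!natr_sum sum_geometric2. Qed.

Lemma zexcess_sum_ge0 w k : k <= count negb w -> (0 <= \sum_(j < k) zexcess w j)%R.
Proof.
by move=> le_k; rewrite zexcess_sum subr_ge0 ler_nat mulnC zval_sum_lower.
Qed.

Theorem theorem5 (p q : nat) (hp : 1 <= p) (hpq : p < q - p)
  (w : seq bool) (hw : size w = q) (hones : count id w = p)
  (hnot : forall k : nat, w != iter k sigma (u_word p q)) :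
  Pw (u_word p q) < Pw w.
Proof.
move: hpq hnot; rewrite /u_word; set n := q - p => lt_pn nw.
have qE : q = n + p by rewrite subnK // -hones -hw count_size.
have sw : size w = n + p by rewrite hw.
have nE : count negb w = n.
  by have := count_predC id w; rewrite sw hones addnC => /eqP; rewrite eqn_add2r => /eqP.
have n_gt0 : 0 < n by apply: leq_ltn_trans lt_pn.
pose w' := map negb w.
have [nE' pE'] : count negb w' = p /\ count id w' = n.
  by rewrite count_negb_map count_id_map.
have sw' : size w' = n + p by rewrite size_map.
pose N := 2 ^ (n + p) - 1.
have z_gt j : j < n -> 2 ^ p - 1 < zval w j.
  by rewrite -nE; apply: zval_gt_min nw _.
have z_le j : j < n -> 2 * zval w j <= N by rewrite /N -sw -nE; apply: zval_upper.
have z'_le j : j < p -> 2 * zval w' j <= N by rewrite /N -sw' -nE'; apply: zval_upper.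
have N_gt0 : 0 < N by have := z_le 0 n_gt0; have := z_gt 0 n_gt0; lia.
(* This keeps the truncated subtraction in [x] exact. *)
have x'_le j : j < p -> 2 ^ j * (2 ^ n - 1) <= N.
  move=> lt_j; have : 2 ^ j <= 2 ^ p by rewrite leq_exp2l // ltnW.
  by rewrite /N expnD; have := expn_gt0 2 n; nia.
(* The first [n] indices carry the rotations starting with 0 in increasing order, the last [p] those
   starting with 1 in decreasing order. *)
pose x (i : 'I_(n + p)) : nat :=
  match split i with
  | inl j => 2 ^ j * (2 ^ p - 1) | inr j => N - 2 ^ j * (2 ^ n - 1) end.
pose y (i : 'I_(n + p)) : nat :=
  match split i with inl j => zval w j | inr j => N - zval w' j end.
have split_l j : split (lshift p j : 'I_(n + p)) = inl j by rewrite (unsplitK (inl j)).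
have split_r j : split (rshift n j : 'I_(n + p)) = inr j by rewrite (unsplitK (inr j)).
have -> : Pw (nseq n false ++ nseq p true) = \prod_i x i.
  rewrite Pw_u_word big_split_ord /x.
  by congr (_ * _); apply: eq_bigr => j _; rewrite ?split_l ?split_r.
have -> : Pw w = \prod_i y i.
  rewrite PwE (big_rot _ id) nE hones sw big_split_ord /y.
  by congr (_ * _); apply: eq_bigr => j _; rewrite ?split_l ?split_r.
have y_gt0 i : 0 < y i.
  rewrite /y; case: (split i) => j; first by have := z_gt j (ltn_ord j); lia.
  by have := z'_le j (ltn_ord j); lia.
rewrite -(ltr_nat rat) !natr_prod.
(* Strictness is taken at index 0, where the smallest rotations are paired. *)
apply: (@prod_lt_of_sum_ratio _ _ _ _ (lshift p (Ordinal n_gt0))).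
- by move=> i; rewrite ler0n.
- by move=> i; rewrite ltr0n.
(* [N / 2] separates the two groups of values, so [G] bounds both weights: [1 / zval w j >= G] and
   [1 / (N - zval w' j) <= G]. *)
- pose G : rat := (2 / N%:R)%R.
  have N0 : (0 < N%:R :> rat)%R by rewrite ltr0n.
  have zeros_le : (\sum_(j < n) zexcess w j * - (zval w j)%:R^-1
      <= - G * \sum_(j < n) zexcess w j)%R.
    apply: (@abel_sum_le _ n (zexcess w) (fun j => - (zval w j)%:R^-1)%R).
    + by move=> k; rewrite -nE; apply: zexcess_sum_ge0.
    + move=> i j le_ij lt_j; rewrite lerN2 lef_pV2 ?posrE ?ltr0n.
      * by rewrite ler_nat zval_homo // nE.
      * by apply: leq_ltn_trans (z_gt j lt_j).
      * by apply: leq_ltn_trans (z_gt i (leq_ltn_trans le_ij lt_j)).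
    + move=> i lt_i; have zi : 0 < zval w i by apply: leq_ltn_trans (z_gt i lt_i).
      rewrite lerN2 /G ler_pdivrMr // mulrC ler_pdivlMr ?ltr0n //.
      by rewrite -natrM ler_nat z_le.
  have ones_le : (\sum_(j < p) zexcess w' j * (N - zval w' j)%:R^-1
      <= G * \sum_(j < p) zexcess w' j)%R.
    apply: (@abel_sum_le _ p (zexcess w') (fun j => (N - zval w' j)%:R^-1)%R).
    + by move=> k; rewrite -nE'; apply: zexcess_sum_ge0.
    + move=> i j le_ij lt_j; have zj := z'_le j lt_j.
      have zij : zval w' i <= zval w' j by rewrite zval_homo // nE'.
      by rewrite lef_pV2 ?posrE ?ltr0n ?ler_nat; lia.
    + move=> i lt_i; have zi := z'_le i lt_i.
      have d0 : 0 < N - zval w' i by lia.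
      rewrite /G ler_pdivlMr // mulrC ler_pdivrMr ?ltr0n //.
      by rewrite -natrM ler_nat; lia.
  (* The subtracted total [(2 ^ n - 1) * (2 ^ p - 1)] is symmetric in [n] and [p], so the boundary
     terms with [-G] and [G] will cancel. *)
  have excess_eq : (\sum_(j < n) zexcess w j = \sum_(j < p) zexcess w' j)%R.
    rewrite !zexcess_sum hones pE' mulnC; congr (_%:R - _)%R.
    by have := zval_sum_negb w; rewrite nE hones.
  (* Each ratio is 1 plus [(x i - y i) / y i]; the numerator is minus the excess for rotations
     starting with 0 and, by complementation, plus the excess for the others. *)
  have -> : (\sum_i (x i)%:R / (y i)%:R = (n + p)%:R
      + \sum_(j < n) zexcess w j * - (zval w j)%:R^-1
      + \sum_(j < p) zexcess w' j * (N - zval w' j)%:R^-1 :> rat)%R.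
    have natE m : (m%:R = \sum_(j < m) 1 :> rat)%R by rewrite sumr_const card_ord.
    rewrite big_split_ord /= natrD -addrA addrACA (natE n) (natE p) -!big_split /=.
    congr (_ + _)%R; apply: eq_bigr => j _.
    + rewrite /x /y split_l /zexcess hones.
      have : ((zval w j)%:R != 0 :> rat)%R.
        by rewrite pnatr_eq0 -lt0n; apply: leq_ltn_trans (z_gt j (ltn_ord j)).
      by move=> ?; field.
    + rewrite /x /y split_r /zexcess pE'; have zj := z'_le j (ltn_ord j).
      have zN : zval w' j <= N by lia.
      rewrite (natrB _ (x'_le j (ltn_ord j))) (natrB _ zN).
      have : ((N%:R - (zval w' j)%:R) != 0 :> rat)%R.
        by rewrite -(natrB _ zN) pnatr_eq0; lia.
      by move=> ?; field.
  rewrite -addrA gerDl; apply: le_trans (lerD zeros_le ones_le) _.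
  by rewrite excess_eq mulNr addNr.
- by rewrite ltr_nat /x /y split_l expn0 mul1n z_gt.
Qed.
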